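(* Consider a non-smooth problem in the class $\mathcal{NSP}(g,\sigma_f)$ and let $\{(z_{k-1},x_k,g_k,\hat x_k)\}_{k\ge 0}$ be generated by Method N (either the classical or the modified variant) with weight parameters $\{\lambda_k\}_{k\ge0}$ and scaling parameters $\{\beta_k\}_{k\ge-1}$, where $\beta_{-1}+\lambda_0\sigma_f>0$. Then for every $k\ge 0$ $$f(\hat x_k)-f(x^* )+\sigma_f\,\xi(z_k,x^* )\le \frac{\beta_k\, l_d(z_k;x^* )+C_k}{S_k},$$ where $$C_k:=\frac{1}{2\sigma_d}\sum_{i=0}^k\frac{\lambda_i^2}{\beta_{i-1}+S_i\sigma_f}\|g_i\|_*^2\quad\text{for the classical method},$$ $$C_k:=\frac{1}{2\sigma_d}\sum_{i=0}^k\frac{\lambda_i^2S_i}{\lambda_i^2\sigma_f+S_i(\beta_{i-1}+S_{i-1}\sigma_f)}\|g_i\|_*^2\quad\text{for the modified method}.$$ Furthermore, for the classical method (with $C_k$ as defined for the classical method) and every $k\ge0$, $$\frac{1}{S_k}\sum_{i=0}^k\lambda_i f(x_i)-f(x^* )+\sigma_f\xi(z_k,x^* )\le \frac{\beta_k\, l_d(z_k;x^* )+C_k}{S_k}$$ and $$\min_{0\le i\le k}f(x_i)-f(x^* )+\sigma_f\xi(z_k,x^* )\le \frac{\beta_k\, l_d(z_k;x^* )+C_k}{S_k}.$$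
   Context: Setting. $E$ is a finite-dimensional real normed space with norm $\|\cdot\|$; $E^*$ is its dual, with pairing $\langle s,x\rangle$ and dual norm $\|s\|_*=\max_{\|x\|\le 1}\langle s,x\rangle$. $Q\subset E$ is a closed convex set and $f:E\to\mathbb R\cup\{+\infty\}$ is a lower-semicontinuous (lsc) convex function with $Q\subset \mathrm{dom} f$. The problem $\min_{x\in Q}f(x)$ is assumed to have an optimal solution; $x^*\in Q$ denotes one. A prox-function $d:E\to\mathbb R\cup\{+\infty\}$ is fixed: $d$ is nonnegative, continuously differentiable and strongly convex on $Q$ ($Q\subset\mathrm{dom}\,d$) with constant $\sigma_d>0$ with respect to $\|\cdot\|$, and $d(x_0)=\min_{x\in Q}d(x)=0$ for its unique minimizer $x_0\in Q$. For $x,y\in Q$: $l_d(y;x):=d(y)+\langle\nabla d(y),x-y\rangle$ and $\xi(y,x):=d(x)-l_d(y;x)$ (Bregman distance). For an lsc convex $\psi:E\to\mathbb R\cup\{+\infty\}$ with $Q\subset\mathrm{dom}\,\psi$, $\sigma(\psi):=\{\tau\ge0:\psi(x)-\tau d(x)\text{ is an lsc convex function on }Q\}$. Class $\mathcal{NSP}(g,\sigma_f)$: problems $\min_{x\in Q}f(x)$ for which a subgradient mapping $g(x)\in\partial f(x)$, $x\in Q$, and a number $\sigma_f\in\sigma(f)$ are given. One sets $m_f(y;x):=f(y)+\langle g(y),x-y\rangle+\sigma_f\xi(y,x)$. It is assumed that $\min_{x\in Q}\{\langle s,x\rangle+\beta d(x)\}$ is solvable for every $s\in E^*$, $\beta>0$.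 Parameters. Weight parameters $\lambda_k>0$ ($k\ge0$); scaling parameters $\beta_k\ge0$ ($k\ge-1$), nondecreasing in $k$. $S_k:=\sum_{i=0}^k\lambda_i$, $S_{-1}:=0$. Property 1 for a sequence of functions $\{\varphi_k(x)\}_{k\ge-1}$ (associated with $\{\lambda_k\},\{\beta_k\}$, test points $\{x_k\}_{k\ge0}$), with $z_k:=\mathrm{argmin}_{x\in Q}\varphi_k(x)$ (minimizers are assumed to exist; $Q$ is assumed bounded if $\varphi_k$ may be affine): (A1) $\varphi_{-1}(z_{-1})=0$ and $z_{-1}=x_0$. (A2) For all $k\ge-1$, $x\in Q$: $\varphi_{k+1}(x)\ge\varphi_k(z_k)+\lambda_{k+1}m_f(x_{k+1};x)+\beta_{k+1}d(x)-\beta_kl_d(z_k;x)+S_k\sigma_f\xi(z_k,x)$. (A3) For all $k\ge-1$: $\varphi_k(z_k)\le\min_{x\in Q}\{\sum_{i=0}^k\lambda_im_f(x_i;x)+\beta_kl_d(z_k;x)-S_k\sigma_f\xi(z_k,x)\}$. Method N. Set $\hat x_0:=x_0:=z_{-1}:=\mathrm{argmin}_{x\in Q}d(x)$. For $k\ge0$ set $g_k:=g(x_k)\in\partial f(x_k)$ and, with a sequence $\{\varphi_k\}_{k\ge-1}$ satisfying Property 1, classical method: $x_{k+1}:=z_k:=\mathrm{argmin}_{x\in Q}\varphi_k(x)$, $\ \hat x_{k+1}:=\frac{S_k\hat x_k+\lambda_{k+1}z_k}{S_{k+1}}$; modified method: $z_k:=\mathrm{argmin}_{x\in Q}\varphi_k(x)$,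 $\ \hat x_{k+1}:=x_{k+1}:=\frac{S_k\hat x_k+\lambda_{k+1}z_k}{S_{k+1}}$. *)

(* Defs.v *)
From HB Require Import structures.
From mathcomp Require Import all_boot all_order all_algebra.
From mathcomp Require Import all_classical all_reals all_analysis.

Set Implicit Arguments.
Unset Strict Implicit.
Unset Printing Implicit Defensive.

Import Order.TTheory GRing.Theory Num.Theory.
Import numFieldNormedType.Exports.

Local Open Scope classical_set_scope.
Local Open Scope ring_scope.

#[short(type="finNormedModType")]
HB.structure Definition FinNormedModule (R : numFieldType) :=
  {E of Vector R E & NormedModule R E}.

Section Dual.
Context {R : realType} {E : normedModType R}.

(* In finite dimension every linear form is continuous, so this is E^*. *)
Record dual := Dual {
  dual_form :> {linear E -> R^o};
  dual_continuous : continuous dual_form }.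

Definition pairing (s : dual) (x : E) : R := s x.

(* Stated for arbitrary functions so that it applies to s \- t directly. *)
Definition dual_norm (s : E -> R) : R :=
  sup [set s x | x in [set x : E | `|x| <= 1]].

End Dual.
Arguments dual {R} E.

Section ConvexAnalysis.
Context {R : realType} {E : normedModType R}.
Implicit Types (Q : set E) (h d psi : E -> \bar R).
Local Open Scope ereal_scope.

(* A function E -> R u {+oo} is rendered as h : E -> \bar R with values > -oo. *)
Definition proper_valued h := forall x, -oo < h x.

Definition dom h : set E := [set x | h x < +oo].

Definition argmin Q h : set E :=
  [set z | Q z /\ forall x, Q x -> h z <= h x].

Definition convex_on Q h := forall (x y : E) (t : R),
  Q x -> Q y -> (0 <= t <= 1)%R ->
  h (t *: x + (1 - t) *: y)%R <= t%:E * h x + (1 - t)%:E * h y.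

(* Lower semicontinuity relative to Q, that is, for the subspace topology. *)
Definition lsc_on Q h := @lower_semicontinuous (subspace Q) R h.

Definition strongly_convex_on Q (sigma : R) h := forall (x y : E) (t : R),
  Q x -> Q y -> (0 <= t <= 1)%R ->
  h (t *: x + (1 - t) *: y)%R
    <= t%:E * h x + (1 - t)%:E * h y
       - (sigma / 2 * t * (1 - t) * `|x - y| ^+ 2)%:E.

Definition subdifferential h (x : E) : set (dual E) :=
  [set s | forall y, h x + (pairing s (y - x))%:E <= h y].

(* h is continuously differentiable on Q, with gradient map Dh: Dh y is a
   Frechet derivative of h at y relative to Q, and Dh is continuous on Q for
   the dual norm. Since Q may have empty interior and h may be +oo off Q, only
   points of Q are tested; for y and x in the convex set Q this determines
   pairing (Dh y) (x - y), the only quantity used below. *)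
Definition C1_on Q h (Dh : E -> dual E) := forall y, Q y ->
  (forall e : R, (0 < e)%R -> \forall x \near within Q (nbhs y),
     `| h x - h y - (pairing (Dh y) (x - y))%:E | <= (e * `|x - y|)%:E) /\
  (forall e : R, (0 < e)%R -> \forall x \near within Q (nbhs y),
     (dual_norm (Dh x \- Dh y) < e)%R).

Record prox_function Q d (Dd : E -> dual E) (sigma_d : R) (x0 : E) : Prop :=
  ProxFunction {
  prox_proper : proper_valued d;
  prox_dom : Q `<=` dom d;
  prox_ge0 : forall x, Q x -> 0 <= d x;
  prox_C1 : C1_on Q d Dd;
  prox_sigma_gt0 : (0 < sigma_d)%R;
  prox_strongly_convex : strongly_convex_on Q sigma_d d;
  prox_center : argmin Q d = [set x0];
  prox_center0 : d x0 = 0;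
  prox_solvable : forall (s : dual E) (b : R), (0 < b)%R ->
    argmin Q (fun x => (pairing s x)%:E + b%:E * d x) !=set0 }.

Definition sigma_set Q d psi : set R :=
  [set tau | [/\ (0 <= tau)%R, lsc_on Q (fun x => psi x - tau%:E * d x)
               & convex_on Q (fun x => psi x - tau%:E * d x)]].

Definition lin_d d (Dd : E -> dual E) (y x : E) : \bar R :=
  d y + (pairing (Dd y) (x - y))%:E.

Definition bregman d (Dd : E -> dual E) (y x : E) : \bar R :=
  d x - lin_d d Dd y x.

Record NSP Q d (f : E -> \bar R) (g : E -> dual E) (sigma_f : R) : Prop :=
  Nsp {
  nsp_proper : proper_valued f;
  nsp_lsc : lower_semicontinuous f;
  nsp_convex : convex_on setT f;
  nsp_dom : Q `<=` dom f;
  nsp_subgrad : forall x, Q x -> subdifferential f x (g x);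
  nsp_sigma : sigma_set Q d f sigma_f }.

Definition model d (Dd : E -> dual E) (f : E -> \bar R) (g : E -> dual E)
    (sigma_f : R) (y x : E) : \bar R :=
  f y + (pairing (g y) (x - y))%:E + sigma_f%:E * bregman d Dd y x.

End ConvexAnalysis.

(* Index shift: the sequences beta, phi, z and S, which start at index -1 in
   the mathematics, are represented by sequences over nat starting at 0, so
   that beta n, phi n, z n, Ssum lam n stand for beta_{n-1}, phi_{n-1},
   z_{n-1}, S_{n-1}. The sequences lam, x, xhat start at index 0 and are not
   shifted. *)
Section Method.
Context {R : realType} {E : normedModType R}.
Local Open Scope ereal_scope.

Definition Ssum (lam : nat -> R) (n : nat) : R := (\sum_(i < n) lam i)%R.

Record property1 (Q : set E) (d : E -> \bar R) (Dd : E -> dual E) (x0 : E)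
    (f : E -> \bar R) (g : E -> dual E) (sigma_f : R)
    (lam beta : nat -> R) (x : nat -> E)
    (phi : nat -> E -> \bar R) (z : nat -> E) : Prop := Property1 {
  p1_argmin : forall n, argmin Q (phi n) (z n);
  p1_A1 : phi 0%N (z 0%N) = 0 /\ z 0%N = x0;
  p1_A2 : forall n y, Q y ->
    phi n.+1 y >= phi n (z n) + (lam n)%:E * model d Dd f g sigma_f (x n) y
      + (beta n.+1)%:E * d y - (beta n)%:E * lin_d d Dd (z n) y
      + (Ssum lam n * sigma_f)%:E * bregman d Dd (z n) y;
  p1_A3 : forall n,
    phi n (z n) <= ereal_inf
      [set \sum_(i < n) (lam i)%:E * model d Dd f g sigma_f (x i) y
           + (beta n)%:E * lin_d d Dd (z n) y
           - (Ssum lam n * sigma_f)%:E * bregman d Dd (z n) y | y in Q] }.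

Variant method_variant := Classical | Modified.

Definition methodN (v : method_variant) (x0 : E) (lam : nat -> R)
    (z x xhat : nat -> E) : Prop :=
  [/\ z 0%N = x0, x 0%N = x0, xhat 0%N = x0
    & forall k : nat,
        (xhat k.+1 = (Ssum lam k.+2)^-1 *:
          (Ssum lam k.+1 *: xhat k + lam k.+1 *: z k.+1))%R /\
        x k.+1 = match v with
                 | Classical => z k.+1
                 | Modified => xhat k.+1
                 end].

Definition Cbound (v : method_variant) (sigma_d sigma_f : R)
    (lam beta : nat -> R) (g : E -> dual E) (x : nat -> E) (k : nat) : R :=
  ((2 * sigma_d)^-1 * \sum_(i < k.+1)
    match v with
    | Classical =>
        lam i ^+ 2 / (beta i + Ssum lam i.+1 * sigma_f)
    | Modified =>
        lam i ^+ 2 * Ssum lam i.+1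
        / (lam i ^+ 2 * sigma_f
           + Ssum lam i.+1 * (beta i + Ssum lam i * sigma_f))
    end * dual_norm (g (x i)) ^+ 2)%R.

End Method.

(* Main.v *)
(* Estimate sequences: with psi_k = min phi_k, the bound
   S_k f(xhat_k) <= psi_k + C_k (for the classical method even with
   sum_i lambda_i f(x_i) on the left) follows by induction on k. The step
   evaluates (A2) at y = z_{k+1}: the linear term lambda <g, y - z_k> is
   absorbed, by completing the square, in the Bregman terms, which dominate
   (sigma_d/2) |.|^2. For the modified method the old value f(xhat_k) is bounded
   below by the model at x_{k+1}, so that the linear terms recombine through
   S_{k+1} x_{k+1} = S_k xhat_k + lambda_{k+1} z_k, and convexity of |.|^2 turns
   the two Bregman terms based at x_{k+1} into
   (lambda^2/S_{k+1}) (sigma_d/2) |y - z_k|^2. Conversely (A3) at x^* bounds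
   psi_k above, since the model minorizes f: this is where the convexity of
   f - sigma_f d enters. *)
Require Import Defs.
From mathcomp Require Import all_boot all_order all_algebra.
From mathcomp Require Import all_classical all_reals all_analysis.
From mathcomp Require Import ring lra.

Import Order.TTheory GRing.Theory Num.Theory.
Import numFieldNormedType.Exports.

Local Open Scope classical_set_scope.
Local Open Scope ring_scope.

(** * Dual norm, and first-order inequalities for the prox-function and the model *)

Section Analysis.
Context {R : realType} {E : normedModType R}.
Implicit Types (Q : set E) (d : E -> \bar R) (s : dual E) (x y : E) (t : R).

Lemma pairingD s x y : pairing s (x + y) = pairing s x + pairing s y.
Proof. exact: linearD. Qed.

Lemma pairingZ s t x : pairing s (t *: x) = t * pairing s x.
Proof. exact: linearZ. Qed.

Lemma pairing_le_dual_norm s x : pairing s x <= dual_norm s * `|x|.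
Proof.
have [->|x0] := eqVneq x 0; first by rewrite /pairing linear0 normr0 mulr0.
have nx : 0 < `|x| by rewrite normr_gt0.
rewrite -ler_pdivrMr // mulrC -pairingZ /dual_norm.
apply: ub_le_sup; last first.
  by exists (`|x|^-1 *: x) => //=; rewrite normrZ normfV normr_id mulVf ?gt_eqF.
(* [sup] dominates its set only when the set is bounded above; continuity of the form [s] supplies
   that bound on the unit ball. *)
have /linear_boundedP := continuous_linear_bounded 0 (@dual_continuous _ _ s 0).
move=> /pinfty_ex_gt0[M M0 bM].
exists M => _ [y /= y1 <-].
apply: (le_trans (ler_norm _)); apply: (le_trans (bM y)).
by rewrite ler_piMr // ltW.
Qed.

Lemma norm_pairing_le s x : `|pairing s x| <= dual_norm s * `|x|.
Proof.
rewrite ler_norml pairing_le_dual_norm andbT lerNl -mulN1r -pairingZ scaleN1r.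
by rewrite -normrN pairing_le_dual_norm.
Qed.

Lemma convex_set_segment Q x y t : convex_set Q -> Q x -> Q y ->
  0 <= t <= 1 -> Q (t *: x + (1 - t) *: y).
Proof.
move=> cQ Qx Qy /andP[t0 t1].
have := cQ x y (Itv01 t0 t1); rewrite !inE; exact.
Qed.

(** First-order expansion along the segment from [y] towards [x], at one small step [t]. The extra
    bound [t <= e] lets later arguments divide by [t] and send only [e] to 0, in place of a limit in
    [t]. *)
Lemma C1_on_segment Q d Dd x y (e : R) : convex_set Q -> C1_on Q d Dd ->
  (forall u, Q u -> d u \is a fin_num) -> Q x -> Q y -> 0 < e ->
  exists t, [/\ 0 < t, t <= e, t <= 1 &
    `|fine (d (t *: x + (1 - t) *: y)) - fine (d y)
      - t * pairing (Dd y) (x - y)| <= e * t].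
Proof.
move=> cQ C1 fd Qx Qy e0.
have n0 : 0 < `|x - y| + 1 by rewrite ltr_wpDl.
have [/(_ (e / (`|x - y| + 1)) (divr_gt0 e0 n0)) + _] := C1 y Qy.
rewrite near_withinE => /nbhs_normP[r /= r0 nr].
(* The last bound keeps the point within distance [r] of [y]; the added 1 covers [x = y]. *)
pose t := Num.min (Num.min e 1) (r / 2 / (`|x - y| + 1)).
have t0 : 0 < t by rewrite !lt_min e0 ltr01 !divr_gt0.
have [te t1 tr] : [/\ t <= e, t <= 1 & t <= r / 2 / (`|x - y| + 1)].
  by split; rewrite /t !ge_min lexx ?orbT.
exists t; split => //.
have Qt : Q (t *: x + (1 - t) *: y).
  by apply: convex_set_segment => //; rewrite ltW.
have tE : t *: x + (1 - t) *: y - y = t *: (x - y).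
  by rewrite scalerBl scale1r scalerBr -addrA addrAC subrr add0r.
have ntE : `|t *: x + (1 - t) *: y - y| = t * `|x - y|.
  by rewrite tE normrZ gtr0_norm.
have := nr (t *: x + (1 - t) *: y); rewrite /= distrC ntE => /(_ _ Qt).
rewrite tE pairingZ -(fineK (fd _ Qt)) -(fineK (fd _ Qy)).
rewrite -!EFinB lee_fin => H.
apply: (le_trans (H _)); last first.
  rewrite mulrAC ler_pdivrMr // (mulrC t) mulrA mulrAC ler_wpM2l //.
    by rewrite mulr_ge0 // ltW.
  by rewrite lerDl.
move: tr; rewrite ler_pdivlMr // mulrDr mulr1 => tr.
by rewrite (le_lt_trans (y := r / 2)) //; lra.
Qed.

Lemma le_of_eps (a b c : R) : 0 < c -> (forall e, 0 < e -> a <= b + e * c) ->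
  a <= b.
Proof.
move=> c0 H; apply/ler_addgt0Pr => e e0.
by have := H (e / c) (divr_gt0 e0 c0); rewrite divfK // gt_eqF.
Qed.

Definition breg (D : E -> R) (Dd : E -> dual E) (y x : E) : R :=
  D x - D y - pairing (Dd y) (x - y).

Lemma bregmanE d Dd y x : d y \is a fin_num -> d x \is a fin_num ->
  bregman d Dd y x = (breg (fine \o d) Dd y x)%:E.
Proof.
move=> fy fx; rewrite /bregman /lin_d -(fineK fy) -(fineK fx) /=.
by rewrite -!EFinD /breg /= opprD addrA.
Qed.

(** Strong convexity bounds the increment of [d] along the segment from above, the expansion bounds
    it from below; divide by [t] and let [e] tend to 0. *)
Lemma strongly_convex_breg_ge Q d Dd (sigma : R) x y : convex_set Q ->
  C1_on Q d Dd -> (forall u, Q u -> d u \is a fin_num) -> 0 <= sigma ->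
  strongly_convex_on Q sigma d -> Q x -> Q y ->
  sigma / 2 * `|x - y| ^+ 2 <= breg (fine \o d) Dd y x.
Proof.
move=> cQ C1 fd s0 sc Qx Qy.
set n2 := `|x - y| ^+ 2.
have n20 : 0 <= sigma / 2 * n2 by rewrite mulr_ge0 ?divr_ge0 ?exprn_ge0.
(* The 1 stands for the expansion error; the other summand pays for the factor [1 - t] in strong
   convexity, through [t <= e]. *)
apply: (@le_of_eps _ _ (1 + sigma / 2 * n2)) => [|e e0]; first by lra.
have [t [t0 te t1]] := C1_on_segment Q d Dd x y e cQ C1 fd Qx Qy e0.
have t01 : 0 <= t <= 1 by rewrite t1 ltW.
have := sc x y t Qx Qy t01.
have Qu := convex_set_segment Q x y t cQ Qx Qy t01.
rewrite -(fineK (fd _ Qu)) -(fineK (fd _ Qx)) -(fineK (fd _ Qy)) /breg /=.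
rewrite -/n2 -!EFinM -!EFinD lee_fin ler_norml => H1 /andP[H2 _].
rewrite -(ler_pM2l t0).
have : t * (sigma / 2 * n2) * t <= t * (sigma / 2 * n2) * e.
  by rewrite ler_wpM2l // mulr_ge0 // ltW.
by lra.
Qed.

(** At a point of the segment, the subgradient bounds [f] from below and convexity of [f - sigma d]
    bounds it from above. Expanding [d] to first order and dividing by [t] leaves the Bregman
    term. *)
Lemma model_le Q d Dd (f : E -> \bar R) g (sigma : R) x y : convex_set Q ->
  C1_on Q d Dd -> (forall u, Q u -> d u \is a fin_num) ->
  (forall u, Q u -> f u \is a fin_num) ->
  subdifferential f y (g y) -> sigma_set Q d f sigma -> Q x -> Q y ->
  fine (f y) + pairing (g y) (x - y) + sigma * breg (fine \o d) Dd y x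
    <= fine (f x).
Proof.
move=> cQ C1 fd ff sg [s0 _ cv] Qx Qy.
(* The error is [sigma * e]; the added 1 keeps the constant positive when [sigma = 0]. *)
apply: (@le_of_eps _ _ (sigma + 1)) => [|e e0]; first by lra.
have [t [t0 te t1]] := C1_on_segment Q d Dd x y e cQ C1 fd Qx Qy e0.
have t01 : 0 <= t <= 1 by rewrite t1 ltW.
have Qu := convex_set_segment Q x y t cQ Qx Qy t01.
have := sg (t *: x + (1 - t) *: y); have := cv x y t Qx Qy t01.
have -> : t *: x + (1 - t) *: y - y = t *: (x - y).
  by rewrite scalerBl scale1r scalerBr -addrA addrAC subrr add0r.
rewrite pairingZ.
rewrite -(fineK (fd _ Qu)) -(fineK (fd _ Qx)) -(fineK (fd _ Qy)) /breg /=.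
rewrite -(fineK (ff _ Qu)) -(fineK (ff _ Qx)) -(fineK (ff _ Qy)) /=.
rewrite !(=^~ EFinD, =^~ EFinM, =^~ EFinN) !lee_fin ler_norml.
move=> H1 H2 /andP[_ H3].
rewrite -(ler_pM2l t0).
have : sigma * (fine (d (t *: x + (1 - t) *: y)) - fine (d y)
    - t * pairing (Dd y) (x - y)) <= sigma * (e * t) by rewrite ler_wpM2l.
have : 0 <= e * t by rewrite mulr_ge0 // ltW.
by lra.
Qed.

(* Complete the square in [n]. *)
Lemma quadratic_lower_bound (l G n p c s : R) : 0 < c -> 0 < s -> 0 <= l ->
  `|p| <= G * n ->
  0 <= l * p + c * (s / 2 * n ^+ 2) + (2 * s)^-1 * (l ^+ 2 / c * G ^+ 2).
Proof.
move=> c0 s0 l0; rewrite ler_norml => /andP[pG _].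
have := ler_wpM2l l0 pG => H.
have -> : (2 * s)^-1 * (l ^+ 2 / c * G ^+ 2)
    = c * s / 2 * (l * G / (c * s)) ^+ 2.
  by field; rewrite !gt_eqF.
have : 0 <= c * s / 2 * (n - l * G / (c * s)) ^+ 2.
  by rewrite mulr_ge0 ?exprn_even_ge0 // divr_ge0 // mulr_ge0 // ltW.
have -> : c * s / 2 * (n - l * G / (c * s)) ^+ 2
   = c * s / 2 * n ^+ 2 - l * G * n + c * s / 2 * (l * G / (c * s)) ^+ 2.
  by field; rewrite !gt_eqF.
by lra.
Qed.
End Analysis.

(** * Real-valued forms of the data on [Q], and the weight sums *)

Section Method.
Context {R : realType} {E : normedModType R}.
Context (Q : set E) (cQ : convex_set Q).
Context (d : E -> \bar R) (Dd : E -> dual E) (sigma_d : R) (x0 : E).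
Context (hd : prox_function Q d Dd sigma_d x0).
Context (f : E -> \bar R) (g : E -> dual E) (sigma_f : R).
Context (hf : NSP Q d f g sigma_f).
Context (lam beta : nat -> R) (lam_gt0 : forall k, 0 < lam k).
Context (beta_ge0 : forall n, 0 <= beta n).
Context (beta_nondecr : forall n, beta n <= beta n.+1).
Context (phi : nat -> E -> \bar R) (z x xhat : nat -> E).
Context (hphi : property1 Q d Dd x0 f g sigma_f lam beta x phi z).

Let D := fine \o d.
Let F := fine \o f.
Let S := Ssum lam.
Let xi := breg D Dd.
Let m y u := F y + pairing (g y) (u - y) + sigma_f * xi y u.

Lemma prox_fin_num u : Q u -> d u \is a fin_num.
Proof.
by move=> Qu; rewrite fin_numE -ltNye (prox_proper hd) -ltey (prox_dom hd).
Qed.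

Lemma NSP_fin_num u : Q u -> f u \is a fin_num.
Proof.
by move=> Qu; rewrite fin_numE -ltNye (nsp_proper hf) -ltey (nsp_dom hf).
Qed.

Lemma modelE y u : Q y -> Q u ->
  model d Dd f g sigma_f y u = (m y u)%:E.
Proof.
move=> Qy Qu; rewrite /model bregmanE ?prox_fin_num //.
by rewrite -(fineK (NSP_fin_num _ Qy)) -!(EFinM, EFinD).
Qed.

Lemma lin_dE y u : Q y ->
  lin_d d Dd y u = (D y + pairing (Dd y) (u - y))%:E.
Proof. by move=> Qy; rewrite /lin_d -(fineK (prox_fin_num _ Qy)). Qed.

Lemma sigma_f_ge0 : 0 <= sigma_f.
Proof. by case: (nsp_sigma hf). Qed.

Lemma breg_ge y u : Q y -> Q u -> sigma_d / 2 * `|u - y| ^+ 2 <= xi y u.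
Proof.
move=> Qy Qu; apply: (strongly_convex_breg_ge Q d Dd) => //.
- exact: (prox_C1 hd).
- exact: prox_fin_num.
- exact: ltW (prox_sigma_gt0 hd).
- exact: (prox_strongly_convex hd).
Qed.

Lemma model_le_fine y u : Q y -> Q u -> m y u <= F u.
Proof.
move=> Qy Qu; apply: (model_le Q d Dd f g) => //.
- exact: (prox_C1 hd).
- exact: prox_fin_num.
- exact: NSP_fin_num.
- exact: (nsp_subgrad hf).
- exact: (nsp_sigma hf).
Qed.

Lemma Ssum_recr n : S n.+1 = S n + lam n.
Proof. by rewrite /S /Ssum big_ord_recr. Qed.

Lemma Ssum0 : S 0 = 0.
Proof. by rewrite /S /Ssum big_ord0. Qed.

Lemma Ssum_ge0 n : 0 <= S n.
Proof. by apply: sumr_ge0 => i _; exact: ltW. Qed.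

Lemma Ssum_gt0 n : 0 < S n.+1.
Proof. by rewrite Ssum_recr ltr_wpDl // Ssum_ge0. Qed.

Lemma Ssum_ge_lam0 n : lam 0 <= S n.+1.
Proof.
elim: n => [|n IH]; first by rewrite Ssum_recr Ssum0 add0r.
by rewrite Ssum_recr (le_trans IH) // lerDl ltW.
Qed.

Lemma beta_ge_beta0 n : beta 0 <= beta n.
Proof. by elim: n => [//|n IH]; exact: le_trans (beta_nondecr n). Qed.

Lemma argmin_mem n : Q (z n).
Proof. by have [] := p1_argmin hphi n. Qed.

(** * The averaged points [xhat] *)

Context (xhat0 : xhat 0 = x0).
Context (xhatS : forall k,
  xhat k.+1 = (S k.+2)^-1 *: (S k.+1 *: xhat k + lam k.+1 *: z k.+1)).

Lemma xhat_convex_comb k :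
  exists2 t, 0 <= t <= 1 & [/\ S k.+1 = S k.+2 * t, lam k.+1 = S k.+2 * (1 - t)
    & xhat k.+1 = t *: xhat k + (1 - t) *: z k.+1].
Proof.
have S2 : S k.+2 != 0 by rewrite gt_eqF // Ssum_gt0.
have l1 : lam k.+1 = S k.+2 - S k.+1.
  by rewrite (Ssum_recr k.+1) addrAC subrr add0r.
exists (S k.+1 / S k.+2).
  rewrite divr_ge0 ?Ssum_ge0 //= ler_pdivrMr ?Ssum_gt0 // mul1r.
  by rewrite (Ssum_recr k.+1) lerDl ltW.
split; [by field | by rewrite l1; field |].
rewrite xhatS scalerDr !scalerA l1; congr (_ *: _ + _ *: _); by field.
Qed.

Lemma xhat_mem k : Q (xhat k).
Proof.
elim: k => [|k IH].
  by rewrite xhat0; have [_ <-] := p1_A1 hphi; exact: argmin_mem.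
have [t t01 [_ _ ->]] := xhat_convex_comb k.
by apply: convex_set_segment => //; exact: argmin_mem.
Qed.

(** One recursion for all [k]: at [k = 0] the weight [S 0 = 0] cancels the term with the truncated
    index [k.-1]. *)
Lemma Ssum_xhat k : x0 = z 0 ->
  S k.+1 *: xhat k = S k *: xhat k.-1 + lam k *: z k.
Proof.
move=> x0z; case: k => [|k] /=.
  by rewrite Ssum_recr Ssum0 !add0r scale0r add0r xhat0 x0z.
by rewrite xhatS scalerA divff ?scale1r // gt_eqF // Ssum_gt0.
Qed.

Lemma jensen_xhat k : x0 = z 0 ->
  S k.+1 * F (xhat k) <= \sum_(i < k.+1) lam i * F (z i).
Proof.
move=> x0z; elim: k => [|k IH].
  by rewrite Ssum_recr Ssum0 add0r big_ord1 xhat0 x0z.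
rewrite big_ord_recr /= -lerBlDr; apply: le_trans IH; rewrite lerBlDr.
have Qz := argmin_mem k.+1; have Qk := xhat_mem k.
have Qk1 := xhat_mem k.+1.
have [t t01 [-> -> xE]] := xhat_convex_comb k.
have := nsp_convex hf (x := xhat k) (y := z k.+1) (t := t) I I t01.
rewrite -xE -(fineK (NSP_fin_num _ Qz)) -(fineK (NSP_fin_num _ Qk)).
rewrite -(fineK (NSP_fin_num _ Qk1)) -!EFinM -EFinD lee_fin.
by move=> /(ler_wpM2l (Ssum_ge0 k.+2)); rewrite mulrDr !mulrA.
Qed.

(** * The estimate sequence: finite minima, their growth, and the gap bound *)

Context (Qx : forall n, Q (x n)).

Lemma property1_A3_fine n u : Q u -> exists2 b : R,
  (phi n (z n) <= b%:E)%E &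
  b = \sum_(i < n) lam i * m (x i) u
      + beta n * (D (z n) + pairing (Dd (z n)) (u - z n))
      - S n * sigma_f * xi (z n) u.
Proof.
move=> Qu; eexists; last reflexivity.
apply: (le_trans (p1_A3 hphi n)); apply: ereal_inf_lbound; exists u => //.
have Qz := argmin_mem n.
rewrite lin_dE // bregmanE ?prox_fin_num //.
rewrite [in RHS]EFinB [in RHS]EFinD -sumEFin !EFinM; congr (_ + _ - _)%E.
by apply: eq_bigr => i _; rewrite modelE.
Qed.

Lemma property1_A2_fine n r u : Q u -> phi n (z n) = r%:E ->
  ((r + lam n * m (x n) u + beta n.+1 * D u
    - beta n * (D (z n) + pairing (Dd (z n)) (u - z n))
    + S n * sigma_f * xi (z n) u)%:E <= phi n.+1 u)%E.
Proof.
move=> Qu rE; apply: le_trans (p1_A2 hphi n Qu).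
have Qz := argmin_mem n.
rewrite rE modelE // lin_dE // bregmanE ?prox_fin_num //.
by rewrite -(fineK (prox_fin_num _ Qu)) !(EFinD, EFinM, EFinN).
Qed.

(** By induction: (A2) over a finite previous minimum excludes -oo, and (A3) at a point of [Q]
    excludes +oo. *)
Lemma property1_fin_num n : phi n (z n) \is a fin_num.
Proof.
elim: n => [|n /fineK/esym IH]; first by have [-> _] := p1_A1 hphi.
have := property1_A2_fine n _ (z n.+1) (argmin_mem _) IH.
have [b + _] := property1_A3_fine n.+1 (z n) (argmin_mem _).
by case: (phi _ _).
Qed.

Let psi n := fine (phi n (z n)).

(** In (A2) at [z n.+1], the prox terms equal [(beta n.+1 - beta n) * D (z n.+1)] plus [beta n]
    times a Bregman distance; the former is nonnegative and is dropped. *)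
Lemma psi_step n :
  psi n + lam n * m (x n) (z n.+1)
    + (beta n + S n * sigma_f) * xi (z n) (z n.+1) <= psi n.+1.
Proof.
have := property1_A2_fine n _ (z n.+1) (argmin_mem _)
  (esym (fineK (property1_fin_num n))).
rewrite -(fineK (property1_fin_num n.+1)) lee_fin; apply: le_trans.
rewrite -/(psi n).
have Dz0 : 0 <= D (z n.+1) by apply/fine_ge0/(prox_ge0 hd)/argmin_mem.
have := ler_wpM2r Dz0 (beta_nondecr n).
by rewrite /xi /breg; lra.
Qed.

(* The common last step of all the bounds: [A] is one of f(xhat_k), the
   weighted average of the f(x_i), or their minimum. *)
Lemma gap_le n (A C : R) u : Q u -> S n.+1 * A <= psi n.+1 + C ->
  A - F u + sigma_f * xi (z n.+1) u
    <= (beta n.+1 * (D (z n.+1) + pairing (Dd (z n.+1)) (u - z n.+1)) + C)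
       / S n.+1.
Proof.
move=> Qu hA; rewrite ler_pdivlMr ?Ssum_gt0 //.
have [b + bE] := property1_A3_fine n.+1 u Qu.
rewrite -(fineK (property1_fin_num n.+1)) lee_fin -/(psi n.+1) bE.
have : \sum_(i < n.+1) lam i * m (x i) u <= S n.+1 * F u.
  rewrite /S /Ssum mulr_suml; apply: ler_sum => i _.
  by rewrite ler_wpM2l ?model_le_fine // ltW.
by lra.
Qed.

Lemma gap_le_ereal n (A C : R) u : Q u -> S n.+1 * A <= psi n.+1 + C ->
  (A%:E - f u + sigma_f%:E * bregman d Dd (z n.+1) u
    <= ((beta n.+1)%:E * lin_d d Dd (z n.+1) u + C%:E) / (S n.+1)%:E)%E.
Proof.
move=> Qu hA; have Qz := argmin_mem n.+1.
rewrite bregmanE ?lin_dE ?prox_fin_num // inver gt_eqF ?Ssum_gt0 //.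
by rewrite -(fineK (NSP_fin_num _ Qu)) lee_fin; exact: gap_le.
Qed.

(** * The inductive estimates for the two variants *)

Context (beta_lam_gt0 : 0 < beta 0 + lam 0 * sigma_f).

(** Since [x n = z n], the Bregman term of the model merges with that of [psi_step]: the total
    coefficient [lam n * sigma_f + beta n + S n * sigma_f] is the denominator
    [beta n + S n.+1 * sigma_f]. *)
Lemma classical_estimate n : (forall i, x i = z i) ->
  \sum_(i < n) lam i * F (x i) <= psi n + (2 * sigma_d)^-1 * \sum_(i < n)
     lam i ^+ 2 / (beta i + S i.+1 * sigma_f) * dual_norm (g (x i)) ^+ 2.
Proof.
move=> xz; elim: n => [|n IH].
  by rewrite !big_ord0 mulr0 addr0 /psi; have [-> _] := p1_A1 hphi.
rewrite !big_ord_recr /= mulrDr.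
have c0 : 0 < beta n + S n.+1 * sigma_f.
  apply: lt_le_trans beta_lam_gt0 _; apply: lerD; first exact: beta_ge_beta0.
  by rewrite ler_wpM2r ?sigma_f_ge0 ?Ssum_ge_lam0.
have pG := norm_pairing_le (g (x n)) (z n.+1 - x n).
have := quadratic_lower_bound _ _ _ _ _ _ c0 (prox_sigma_gt0 hd)
  (ltW (lam_gt0 n)) pG.
have := psi_step n; rewrite /m -(xz n).
have := breg_ge (x n) (z n.+1) (Qx n) (argmin_mem _).
move=> /(ler_wpM2l (ltW c0)).
move: IH; rewrite Ssum_recr.
by lra.
Qed.

(** The index [n.-1] undoes the shift of [S] and [psi]; at [n = 0] the left side vanishes because
    [S 0 = 0]. *)
Lemma modified_estimate n :
  (forall i, S i.+1 *: x i = S i *: xhat i.-1 + lam i *: z i) ->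
  (forall i, x i = xhat i) ->
  S n * F (xhat n.-1) <= psi n + (2 * sigma_d)^-1 * \sum_(i < n)
     lam i ^+ 2 * S i.+1
       / (lam i ^+ 2 * sigma_f + S i.+1 * (beta i + S i * sigma_f))
       * dual_norm (g (x i)) ^+ 2.
Proof.
move=> xE xh; elim: n => [|n IH].
  rewrite Ssum0 mul0r !big_ord0 mulr0 addr0 /psi.
  by have [-> _] := p1_A1 hphi.
rewrite big_ord_recr /= mulrDr -xh.
set w := xhat n.-1; set y := z n.+1.
have Qw : Q w by rewrite /w -xh.
have Qy : Q y by exact: argmin_mem.
have S0 := Ssum_gt0 n.
have s0 := sigma_f_ge0.
have l0 := lam_gt0 n.
have Sn0 := Ssum_ge0 n.
have sd0 := prox_sigma_gt0 hd.
have bS0 : 0 <= beta n + S n * sigma_f by rewrite addr_ge0 ?mulr_ge0.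
have c0 : 0 < lam n ^+ 2 * sigma_f + S n.+1 * (beta n + S n * sigma_f).
  (* At [n = 0] the sum factors as [lam 0 * (beta 0 + lam 0 * sigma_f)]. Later the second summand
     alone is positive, because its inner sum already contains the weight [lam 0]. *)
  case: n S0 l0 Sn0 bS0 {IH w y Qw Qy} => [|n] S0 l0 Sn0 bS0.
    rewrite Ssum_recr Ssum0 add0r mul0r addr0 expr2 -mulrA -mulrDr.
    by rewrite addrC mulr_gt0.
  rewrite ltr_wpDl ?mulr_ge0 ?exprn_ge0 ?(ltW l0) // mulr_gt0 //.
  apply: lt_le_trans beta_lam_gt0 _; apply: lerD; first exact: beta_ge_beta0.
  by rewrite ler_wpM2r ?Ssum_ge_lam0.
have comb : S n *: (w - x n) + lam n *: (y - x n) = lam n *: (y - z n).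
  rewrite !scalerBr addrACA -opprD -scalerDl -Ssum_recr xE -/w opprD addrACA.
  by rewrite subrr add0r.
have pairE : S n * pairing (g (x n)) (w - x n)
    + lam n * pairing (g (x n)) (y - x n) = lam n * pairing (g (x n)) (y - z n).
  by rewrite -!pairingZ -pairingD comb.
have normE : lam n ^+ 2 * `|y - z n| ^+ 2
    <= S n.+1 * (S n * `|w - x n| ^+ 2 + lam n * `|y - x n| ^+ 2).
  have : lam n * `|y - z n| <= S n * `|w - x n| + lam n * `|y - x n|.
    have scaleE a (u : E) : 0 <= a -> a * `|u| = `|a *: u|.
      by move=> a0; rewrite normrZ ger0_norm.
    by rewrite !scaleE ?(ltW l0) // -comb ler_normD.
  rewrite -(ler_pXn2r (n := 2)) ?nnegrE ?addr_ge0 ?mulr_ge0 ?(ltW l0) //.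
  rewrite exprMn => /le_trans; apply.
  (* With a, b the two norms, [S n * lam n * (a - b)^2] is exactly [S n.+1 * (S n * a^2 + lam n *
     b^2) - (S n * a + lam n * b)^2]. *)
  have : 0 <= S n * lam n * (`|w - x n| - `|y - x n|) ^+ 2.
    by rewrite mulr_ge0 ?exprn_even_ge0 // mulr_ge0 // ltW.
  by rewrite Ssum_recr; lra.
have pG := norm_pairing_le (g (x n)) (y - z n).
have := quadratic_lower_bound _ _ _ _ _ _ (divr_gt0 c0 S0) sd0 (ltW l0) pG.
rewrite invf_div mulrA.
(* The coefficient of the completed square splits into [lam n ^+ 2 * sigma_f / S n.+1], paid by the
   Bregman terms at [x n] through [normE], and [beta n + S n * sigma_f], paid by the one at
   [z n]. *)
have : (lam n ^+ 2 * sigma_f + S n.+1 * (beta n + S n * sigma_f)) / S n.+1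
      * (sigma_d / 2 * `|y - z n| ^+ 2)
    <= sigma_f * (S n * xi (x n) w + lam n * xi (x n) y)
       + (beta n + S n * sigma_f) * xi (z n) y.
  rewrite mulrDl (mulrC (S n.+1) (_ + _)) mulfK ?gt_eqF // mulrDl.
  apply: lerD; last first.
    by rewrite ler_wpM2l // breg_ge //; exact: argmin_mem.
  rewrite [X in X <= _](_ : _ = sigma_f * ((sigma_d / 2)
    * ((lam n ^+ 2 * `|y - z n| ^+ 2) / S n.+1))); last by ring.
  rewrite ler_wpM2l //.
  apply: (@le_trans _ _ (sigma_d / 2
      * (S n * `|w - x n| ^+ 2 + lam n * `|y - x n| ^+ 2))).
    rewrite ler_wpM2l ?divr_ge0 ?(ltW sd0) // ler_pdivrMr //.
    by rewrite (mulrC _ (S n.+1)).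
  have := ler_wpM2l Sn0 (breg_ge (x n) w (Qx n) Qw).
  have := ler_wpM2l (ltW l0) (breg_ge (x n) y (Qx n) Qy).
  by lra.
have := psi_step n; rewrite -/y.
have := ler_wpM2l Sn0 (model_le_fine (x n) w (Qx n) Qw).
move: IH pairE; rewrite -/w {1}/m [m _ y]/m (Ssum_recr n).
by lra.
Qed.

End Method.

(** * Assembly of the bounds in extended-real form *)

Local Open Scope ereal_scope.

Theorem theorem4p1 (R : realType) (E : finNormedModType R)
    (Q : set E) (Qclosed : closed Q) (Qconvex : convex_set Q)
    (d : E -> \bar R) (Dd : E -> dual E) (sigma_d : R) (x0 : E)
    (hd : prox_function Q d Dd sigma_d x0)
    (f : E -> \bar R) (g : E -> dual E) (sigma_f : R)
    (hf : NSP Q d f g sigma_f)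
    (xstar : E) (hxstar : argmin Q f xstar)
    (lam : nat -> R) (lam_gt0 : forall k, (0 < lam k)%R)
    (beta : nat -> R) (beta_ge0 : forall n, (0 <= beta n)%R)
    (beta_nondecr : forall n, (beta n <= beta n.+1)%R)
    (beta_lam_gt0 : (0 < beta 0%N + lam 0%N * sigma_f)%R)
    (v : method_variant)
    (phi : nat -> E -> \bar R) (z x xhat : nat -> E)
    (hphi : property1 Q d Dd x0 f g sigma_f lam beta x phi z)
    (hN : methodN v x0 lam z x xhat) :
  (forall k : nat,
     f (xhat k) - f xstar + sigma_f%:E * bregman d Dd (z k.+1) xstar
       <= ((beta k.+1)%:E * lin_d d Dd (z k.+1) xstar
           + (Cbound v sigma_d sigma_f lam beta g x k)%:E)
          / (Ssum lam k.+1)%:E)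
  /\
  (v = Classical -> forall k : nat,
     (\sum_(i < k.+1) (lam i)%:E * f (x i)) / (Ssum lam k.+1)%:E
         - f xstar + sigma_f%:E * bregman d Dd (z k.+1) xstar
       <= ((beta k.+1)%:E * lin_d d Dd (z k.+1) xstar
           + (Cbound Classical sigma_d sigma_f lam beta g x k)%:E)
          / (Ssum lam k.+1)%:E
     /\
     \big[Order.min/+oo]_(i < k.+1) f (x i)
         - f xstar + sigma_f%:E * bregman d Dd (z k.+1) xstar
       <= ((beta k.+1)%:E * lin_d d Dd (z k.+1) xstar
           + (Cbound Classical sigma_d sigma_f lam beta g x k)%:E)
          / (Ssum lam k.+1)%:E).
Proof.
have [z0 x0E xhat0 hS] := hN.
have xhatS k := (hS k).1.
have x0z : x0 = z 0%N by [].
have Qz n : Q (z n) by have [] := p1_argmin hphi n.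
have SxhatE k := Ssum_xhat x0 lam lam_gt0 z xhat xhat0 xhatS k x0z.
have Qs : Q xstar by have [] := hxstar.
have Qxhat : forall k, Q (xhat k).
  by apply: (xhat_mem Q _ d Dd x0 f g sigma_f lam beta _ phi z x).
have Qx n : Q (x n).
  by case: n => [|n]; rewrite ?x0E ?x0z // (hS n).2; case: (v).
have fx n : f (x n) = (fine (f (x n)))%:E.
  by rewrite fineK // (NSP_fin_num Q d f g sigma_f).
have gap k A C : (Ssum lam k.+1 * A <= fine (phi k.+1 (z k.+1)) + C)%R -> _ :=
  gap_le_ereal Q Qconvex d Dd sigma_d x0 hd f g sigma_f hf lam beta lam_gt0
    phi z x hphi Qx k A C xstar Qs.
have classical k : v = Classical ->
    (\sum_(i < k.+1) lam i * fine (f (x i)) <= fine (phi k.+1 (z k.+1))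
      + Cbound Classical sigma_d sigma_f lam beta g x k)%R.
  move=> vE; apply: (classical_estimate Q Qconvex d Dd sigma_d x0 hd
    f g sigma_f hf lam beta lam_gt0 beta_nondecr phi z x hphi Qx beta_lam_gt0).
  by case=> [|n]; rewrite ?x0E // (hS n).2 vE.
split=> [k|vE k].
  rewrite -(fineK (NSP_fin_num Q d f g sigma_f hf _ (Qxhat k))); apply: gap.
  case vE : v hN (classical k) => _; last first.
    move=> _.
    apply: (modified_estimate Q Qconvex d Dd sigma_d x0 hd f g sigma_f hf lam
      beta lam_gt0 beta_ge0 beta_nondecr phi z x xhat hphi Qx beta_lam_gt0 k.+1)
      => -[|i].
    - by rewrite x0E -[in LHS]xhat0; exact: (SxhatE 0%N).
    - by rewrite (hS i).2 vE; exact: SxhatE.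
    - by rewrite x0E.
    - by rewrite (hS i).2 vE.
  move=> /(_ erefl); apply: le_trans.
  (* Jensen's sum runs over the [z i], which are the test points [x i] of the classical variant. *)
  apply: le_trans (jensen_xhat Q Qconvex d Dd x0 f g sigma_f hf lam beta lam_gt0
    phi z x xhat hphi xhat0 xhatS k x0z) _.
  rewrite le_eqVlt; apply/orP; left; apply/eqP/eq_bigr => -[[|i] ik] _ /=.
    by rewrite x0E z0.
  by rewrite (hS i).2 vE.
have S0 : (0 < Ssum lam k.+1)%R by exact: Ssum_gt0.
split.
  have -> : \sum_(i < k.+1) (lam i)%:E * f (x i)
      = (\sum_(i < k.+1) lam i * fine (f (x i)))%:E.
    by rewrite -sumEFin; apply: eq_bigr => i _; rewrite [in LHS]fx.
  rewrite [in X in X <= _]inver gt_eqF // -EFinM; apply: gap.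
  by rewrite mulrCA divff ?gt_eqF // mulr1; exact: classical.
(* At a minimizing index [i], [Ssum lam k.+1] times the value is at most the weighted sum, so the
   classical estimate applies. *)
have [i _ imin] := arg_minP (fun j : 'I_k.+1 => fine (f (x j)))
  (erefl true : xpredT ord0).
apply: (@le_trans _ _ ((fine (f (x i)))%:E - f xstar
    + sigma_f%:E * bregman d Dd (z k.+1) xstar)).
  by rewrite !leeD2r // -fx; exact: (bigmin_le _ i).
apply: gap; apply: le_trans (classical k vE).
rewrite /Ssum mulr_suml; apply: ler_sum => j _.
by rewrite ler_wpM2l ?imin // ltW.
Qed.
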